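(* Let $n$ be a positive integer. (i) If $n$ is even and $h_1:\mathbb{F}_{2^n}\to\mathbb{F}_{2^n}$ is $h_1(x)=x^{2^n-2}$, then \[ 2^n-\sqrt{2}\cdot 2^{n/2}-\tfrac{3}{2}\leq d_H(h_1,\mathcal{A})\leq 2^n-2^{n/2}-2. \] (ii) If $n$ is divisible by $4$, $d=2^{n/2-1}+1$ and $h_2(x)=x^d$ on $\mathbb{F}_{2^n}$, then \[ 2^n-\sqrt{2}\cdot 2^{n/2}-\tfrac{1}{2}\leq d_H(h_2,\mathcal{A})\leq 2^n-2^{n/2}-2. \] In particular, $d_H(h_i,\mathcal{A})\leq 2^n-2^{n/2}-1$ for $i=1,2$ under the respective hypotheses.
   Context: $\mathbb{F}_{2^n}$ is viewed as the $\mathbb{F}_2$-vector space $\mathbb{F}_2^n$. For functions $f,g:\mathbb{F}_{2^n}\to\mathbb{F}_{2^n}$, $d_H(f,g)$ is the number of $x$ with $f(x)\neq g(x)$. $\mathcal{A}$ is the set of affine maps $\mathbb{F}_{2^n}\to\mathbb{F}_{2^n}$ (an $\mathbb{F}_2$-linear map plus a constant), and $d_H(f,\mathcal{A})=\min_{A\in\mathcal{A}}d_H(f,A)$. *)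

(* Defs.v *)
From HB Require Import structures.
From mathcomp Require Import all_boot all_order all_algebra all_field.

Set Implicit Arguments.
Unset Strict Implicit.
Unset Printing Implicit Defensive.

Import Order.TTheory GRing.Theory Num.Theory.
Local Open Scope ring_scope.

(* The field with 2^n elements, viewed as an F_2-vector space, is a field
   extension L of 'F_2 with \dim {:L} = n. The alias finvect_type carries the
   finite structure, both on L and on the space 'End(L) of 'F_2-linear
   endomorphisms. *)

Definition dH (L : fieldExtType 'F_2) (f g : L -> L) : nat :=
  #|[set x : finvect_type L | f x != g x]|.

Definition affine_map (L : fieldExtType 'F_2) (g : L -> L) : bool :=
  [exists A : finvect_type 'End(L), exists b : finvect_type L,
     [forall x : finvect_type L, g x == (A : 'End(L)) x + b]].

(* The index #|L| used over an empty range is irrelevant: the range contains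
   the zero map, and every distance is at most #|L|. *)
Definition dH_affine (L : fieldExtType 'F_2) (f : L -> L) : nat :=
  \big[minn/#|finvect_type L|]_(g : {ffun finvect_type L -> finvect_type L}
                                | affine_map g) dH f g.

Lemma affine_mapP (L : fieldExtType 'F_2) (g : L -> L) :
  reflect (exists (A : 'End(L)) (b : L), forall x, g x = A x + b)
          (affine_map g).
Proof.
apply: (iffP existsP) => [[A /existsP[b /forallP gE]]|[A [b gE]]].
  by exists A, b => x; apply/eqP/gE.
exists A; apply/existsP; exists b; apply/forallP => x; exact/eqP/gE.
Qed.

Lemma dH_affine_le (L : fieldExtType 'F_2) (f g : L -> L) :
  affine_map g -> (dH_affine f <= dH f g)%N.
Proof.
move=> /affine_mapP[A [b gE]].
pose G : {ffun finvect_type L -> finvect_type L} := [ffun x : finvect_type L => g x].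
have GE (x : L) : G x = g x by rewrite ffunE.
have aG : affine_map G by apply/affine_mapP; exists A, b => x; rewrite GE.
have -> : dH f g = dH f G by apply: eq_card => x; rewrite !inE GE.
rewrite /dH_affine; elim: index_enum (mem_index_enum G) => //= a s IHs.
rewrite inE big_cons => /predU1P[<-|/IHs le_s]; first by rewrite aG geq_minl.
by case: ifP => // _; rewrite geq_min le_s orbT.
Qed.

Lemma dH_affine_attained (L : fieldExtType 'F_2) (f : L -> L) :
  exists2 g : L -> L, affine_map g & dH_affine f = dH f g.
Proof.
have a0 : affine_map (fun=> 0 : L).
  by apply/affine_mapP; exists 0, 0 => x; rewrite lfunE /= addr0.
suff [E|//] : dH_affine f = #|finvect_type L| \/
    exists2 g : L -> L, affine_map g & dH_affine f = dH f g.
  exists (fun=> 0) => //; apply/eqP.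
  by rewrite eqn_leq dH_affine_le //= E max_card.
apply: (big_ind (fun m => m = #|finvect_type L| \/
    exists2 g : L -> L, affine_map g & m = dH f g)) => [|m p Hm Hp|g ag]; first by left.
  by rewrite /minn; case: ifP.
by right; exists g.
Qed.

(* Main.v *)
(* Upper bounds: on the circle [x ^+ (q + 1) = 1], where [q = 2 ^ m] and
   [n = 2 m], the inverse is [x ^+ q], and [2 d = q + 2] makes [x ^+ d] the
   square root of [x]; both are linear and also agree with the given function
   at [0], that is at [q + 2] points in all.
   Lower bounds: let [S] be the set where [f] agrees with an affine map. If
   [x], [x + a], [y] and [y + a] are in [S], then [f] has the same derivative
   in direction [a] at [x] and [y]. When this forces [y = x] or [y = x + a],
   every nonzero [a] is at most twice a difference of two elements of [S], so
   that [#|S| (#|S| - 1) <= 2 (2 ^ n - 1)]. This applies to the power map [h2],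
   and to the inverse once [0] is removed from [S]. *)

Require Import Defs.
From HB Require Import structures.
From mathcomp Require Import all_boot all_order all_algebra all_field.
From mathcomp Require Import all_solvable ring lra zify.

Import Order.TTheory GRing.Theory Num.Theory.
Local Open Scope ring_scope.

(** Double counting of the pairs [(x, a)] with [a != 0] and [x], [x + a] both in [S]: each [x] has
    [#|S|.-1] partners, while each [a] admits only [x] and [x + a] for one fixed solution [x]. *)
Lemma sidon_card {T : finZmodType} (S : {set T}) :
    (forall a x y : T, a != 0 -> x \in S -> x + a \in S -> y \in S ->
       y + a \in S -> y = x \/ y = x + a) ->
  (#|S| * #|S|.-1 <= 2 * #|T|.-1)%N.
Proof.
move=> sidonS.
have -> : (#|S| * #|S|.-1 = \sum_(x in S) \sum_(a : T | a != 0%R) ((x + a)%R \in S))%N.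
  rewrite -sum_nat_const; apply: eq_bigr => x Sx.
  rewrite (cardD1 x S) Sx -sum1_card big_mkcond /= (reindex_inj (addrI x)) /=.
  rewrite [RHS]big_mkcond; apply: eq_bigr => a _.
  rewrite !inE -subr_eq0 addrAC subrr add0r.
  by case: (a == 0) => //=; case: (_ \in S).
rewrite exchange_big -(cardC1 0) mulnC -sum_nat_const.
rewrite [X in (_ <= X)%N](eq_bigl (fun a => a != 0)) //; apply: leq_sum => a a_neq0.
rewrite -big_mkcondr /= sum1_card.
have [E|[x]] := set_0Vmem [set x in S | x + a \in S].
  by move/setP/eq_card: E; rewrite cards0 cardsE => ->.
rewrite inE => /andP[Sx Sxa].
apply: (@leq_trans #|[set x; x + a]|); last by rewrite cards2; case: (_ != _).
apply: subset_leq_card; apply/subsetP => y /andP[Sy Sya].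
by rewrite !inE; case: (sidonS a x y) => // ->; rewrite eqxx ?orbT.
Qed.

(** Clearing denominators factors the equation as [a * (x - y) * (y + (x + a)) = 0]; in
    characteristic 2 the last factor vanishes exactly at [y = x + a]. *)
Lemma inv_diff_inj {F : fieldType} (a x y : F) :
    2%N \in [pchar F] -> a != 0 -> x != 0 -> x + a != 0 -> y != 0 -> y + a != 0 ->
  (x + a)^-1 - x^-1 = (y + a)^-1 - y^-1 -> y = x \/ y = x + a.
Proof.
move=> pchar2 a0 x0 xa0 y0 ya0 eq_diff.
have /eqP : a * (x - y) * (y + (x + a)) = 0.
  have /eqP := eq_diff; rewrite -subr_eq0 => /eqP eq0.
  rewrite -[RHS](mul0r (x * (x + a) * y * (y + a))) -eq0.
  by field; rewrite y0 ya0 x0.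
rewrite !mulf_eq0 (negbTE a0) subr_eq0 addr_eq0 (oppr_pchar2 pchar2) /=.
by case/orP => /eqP ->; [left|right].
Qed.

Lemma expr_pow2_fixed_iter {F : fieldType} (x : F) (k j : nat) :
  x ^+ (2 ^ k) = x -> x ^+ (2 ^ (k * j)) = x.
Proof.
move=> xk; elim: j => [|j IHj]; first by rewrite muln0 expr1.
by rewrite mulnS expnD exprM xk.
Qed.

Lemma fixed_frobenius_prime_field {F : finFieldType} (m : nat) (t : F) :
  #|F| = (2 ^ m.*2)%N -> odd m.-1 -> t ^+ (2 ^ m.-1) = t -> t = 0 \/ t = 1.
Proof.
move=> cardF odd_k tk.
(* As [m.-1] is odd, the gcd of [2 m] and [m - 1] is [1]. *)
have t4 : t ^+ (2 ^ 2) = t.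
  have := expf_card t; rewrite cardF.
  have -> : (m.*2 = m.-1 * 2 + 2)%N by lia.
  by rewrite expnD exprM expr_pow2_fixed_iter.
have t2 : t ^+ 2 = t.
  move: tk; have -> : (m.-1 = 2 * m.-1./2 + 1)%N by lia.
  by rewrite expnD exprM expr_pow2_fixed_iter.
have /eqP : t * (t - 1) = 0 by rewrite mulrBr mulr1 -expr2 t2 subrr.
by rewrite mulf_eq0 subr_eq0 => /orP[] /eqP; [left|right].
Qed.

(** The power map is quadratic over ['F_2], so its derivative is affine. With [t = (y - x) / a] the
    equation becomes [a ^+ d * (t ^+ (2 ^ m.-1) + t) = 0], which forces [t] into the prime field. *)
Lemma gold_diff_inj {F : finFieldType} (m : nat) (a x y : F) :
    2%N \in [pchar F] -> #|F| = (2 ^ m.*2)%N -> odd m.-1 -> a != 0 ->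
    let d := (2 ^ m.-1 + 1)%N in
  (x + a) ^+ d - x ^+ d = (y + a) ^+ d - y ^+ d -> y = x \/ y = x + a.
Proof.
move=> pchar2 cardF odd_k a0 d eq_diff.
have sD (u v : F) : (u + v) ^+ (2 ^ m.-1) = u ^+ (2 ^ m.-1) + v ^+ (2 ^ m.-1).
  by apply: exprDn_pchar; rewrite pnatX pnatE // pchar2.
pose t := (y - x) / a.
have yE : y = x + t * a by rewrite /t divfK // addrC subrK.
have : t ^+ (2 ^ m.-1) = t.
  move: eq_diff; rewrite yE /d !addn1 !exprSr !sD exprMn => eq_diff.
  have sa0 : a ^+ (2 ^ m.-1) != 0 by rewrite expf_neq0.
  have /eqP : a ^+ (2 ^ m.-1) * a * (t ^+ (2 ^ m.-1) + t) = 0.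
    move/eqP: eq_diff; rewrite eq_sym -subr_eq0 => /eqP <-; ring.
  rewrite !mulf_eq0 (negbTE sa0) (negbTE a0) /= addr_eq0 => /eqP ->.
  exact: oppr_pchar2.
case/(fixed_frobenius_prime_field m t cardF odd_k) => t01; rewrite yE t01.
  by left; rewrite mul0r addr0.
by right; rewrite mul1r.
Qed.

(** The nonzero elements are [#|F|.-1] distinct roots of unity, so one of them is primitive; a
    suitable power [w] of it has order exactly [k], and the [k] powers of [w] are distinct
    solutions. *)
Lemma card_unity_roots_ge {F : finFieldType} (k : nat) :
  (k %| #|F|.-1)%N -> (k <= #|[set x : F | x ^+ k == 1%R]|)%N.
Proof.
move=> dvd_k; set N := #|F|.-1 in dvd_k.
have N_gt0 : (0 < N)%N by rewrite -ltnS prednK ?finNzRing_gt1 ?(ltnW (finNzRing_gt1 _)).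
have /hasP[z _ /dvdn_prim_root/(_ _ dvd_k)] :
    has N.-primitive_root (enum (predC1 (0 : F))).
  apply: has_prim_root; rewrite ?enum_uniq // -?cardE ?cardC1 //.
  apply/allP => x; rewrite mem_enum unity_rootE /= => x0.
  apply/eqP/(mulfI x0); rewrite -exprS mulr1 prednK ?expf_card //.
  exact: ltnW (finNzRing_gt1 _).
move: (z ^+ _) => w prim_w.
have inj_w : injective (fun i : 'I_k => w ^+ i).
  move=> i j /eqP; rewrite (eq_prim_root_expr prim_w) !modn_small //.
  by move/eqP/val_inj.
rewrite -[leqLHS]card_ord -(card_imset _ inj_w); apply: subset_leq_card.
apply/subsetP => _ /imsetP[i _ ->].
by rewrite inE exprAC (prim_expr_order prim_w) expr1n.
Qed.

Lemma pchar2_ext (L : fieldExtType 'F_2) : 2%N \in [pchar L].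
Proof. by rewrite pchar_lalg pchar_Fp. Qed.

Lemma card_ext (L : fieldExtType 'F_2) : #|finvect_type L| = (2 ^ \dim {:L})%N.
Proof.
pose cvL := Vector.class (finvect_type L).
by rewrite -(@card_vspacef 'F_2 (finvect_type L) cvL) card_vspace card_Fp.
Qed.

Lemma affine_frobenius (L : fieldExtType 'F_2) (j : nat) :
  affine_map (fun x : L => x ^+ (2 ^ j)).
Proof.
pose f (x : L) := x ^+ (2 ^ j).
have pnat2j : [pchar L].-nat (2 ^ j)%N by rewrite pnatX pnatE // pchar2_ext.
have fA : zmod_morphism f by move=> x y; rewrite /f exprDn_pchar // exprNn_pchar.
have fZ : scalable f.
  move=> a x; rewrite /f exprZn; congr (_ *: _).
  elim: j {f fA pnat2j} => [|j IHj]; first exact: expr1.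
  (* Scalars are fixed because [a ^+ 2 = a] in ['F_2]. *)
  by rewrite expnSr exprM IHj -[in RHS](expf_card a) card_Fp.
pose fL : {linear L -> L} := HB.pack f
  (GRing.isZmodMorphism.Build _ _ f fA) (GRing.isScalable.Build _ _ _ _ f fZ).
by apply/affine_mapP; exists (linfun fL), 0 => x; rewrite lfunE addr0.
Qed.

Lemma dH_agree (L : fieldExtType 'F_2) (f g : L -> L) :
  (#|[set x : finvect_type L | f x == g x]| + dH f g = #|finvect_type L|)%N.
Proof.
rewrite -(cardsC [set x : finvect_type L | f x == g x]); congr (_ + _)%N.
by apply: eq_card => x; rewrite !inE.
Qed.

(** Completing the square gives [(N - 1/2)^2 <= 2 q^2 - 7/4], which is below [(sqrt 2 * q)^2]. *)
Lemma le_sqrt2 {R : rcfType} (N q : nat) : (0 < q)%N ->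
  (N * N.-1 <= 2 * (q ^ 2).-1)%N -> N%:R <= Num.sqrt 2 * q%:R + 1 / 2 :> R.
Proof.
move=> q_gt0 leN; rewrite leNgt; apply/negP => ltN.
have s0 : 0 <= Num.sqrt 2 :> R by apply: sqrtr_ge0.
have s2 : Num.sqrt 2 ^+ 2 = 2 :> R by rewrite sqr_sqrtr // ler0n.
have q0 : 0 <= q%:R :> R by apply: ler0n.
have leN' : (N * N + 2 <= 2 * q ^ 2 + N)%N by move: leN; case: N {ltN} => [|N] /=; nia.
have : (N%:R * N%:R + 2 <= 2 * q%:R ^+ 2 + N%:R :> R).
  by rewrite -natrX -!natrM -!natrD ler_nat.
have sq0 : 0 <= Num.sqrt 2 * q%:R :> R by apply: mulr_ge0.
have : 2 * q%:R ^+ 2 = (Num.sqrt 2 * q%:R) ^+ 2 :> R by rewrite exprMn s2.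
move: (Num.sqrt 2 * q%:R) sq0 ltN => u u0 ltN -> ; nra.
Qed.

Lemma dH_affine_circle (L : fieldExtType 'F_2) (m j : nat) (f : L -> L) :
    \dim {:L} = m.*2 -> f 0 = 0 ->
    (forall x : L, x ^+ (2 ^ m + 1) = 1 -> f x = x ^+ (2 ^ j)) ->
  (dH_affine f + (2 ^ m + 2) <= 2 ^ m.*2)%N.
Proof.
move=> dimL f0 f_circle; set F := finvect_type L.
have cardF : #|F| = (2 ^ m.*2)%N by rewrite card_ext dimL.
rewrite -[leqRHS]cardF -(dH_agree L f (fun x => x ^+ (2 ^ j))) addnC.
apply: leq_add; last by rewrite dH_affine_le ?affine_frobenius.
have dvd_circle : (2 ^ m + 1 %| #|F|.-1)%N.
  (* Difference of squares: [2 ^ (2 m) - 1 = (2 ^ m - 1) (2 ^ m + 1)]. *)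
  by rewrite cardF -muln2 expnM -subn1 -[X in (_ - X)%N](exp1n 2) subn_sqr dvdn_mull.
have le_circle := card_unity_roots_ge (2 ^ m + 1) dvd_circle.
(* The point [0] lies off the circle and adds one to its [2 ^ m + 1] points. *)
apply: (@leq_trans #|(0 : F) |: [set x : F | x ^+ (2 ^ m + 1) == 1]|).
  rewrite cardsU1 inE expr0n addn1 /= eq_sym oner_eq0 /=.
  by rewrite addn2 add1n ltnS -addn1.
apply: subset_leq_card; apply/subsetP => x; rewrite !inE.
case/orP => [/eqP ->|/eqP x1]; last by rewrite f_circle.
by rewrite f0 expr0n expn_eq0.
Qed.

(** Both differences equal the linear part of [g] evaluated at [a]. *)
Lemma agree_diff (L : fieldExtType 'F_2) (f g : L -> L) (a x y : L) :
  affine_map g -> f x = g x -> f (x + a) = g (x + a) -> f y = g y ->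
  f (y + a) = g (y + a) -> f (x + a) - f x = f (y + a) - f y.
Proof.
case/affine_mapP => A [b gE] -> -> -> ->; rewrite !gE !raddfD /=.
ring.
Qed.

(** Here [c] allows for agreement points discarded before counting: one (the point [0]) for the
    inverse, none for the other power map. *)
Lemma natr_dH_ge {R : rcfType} {L : fieldExtType 'F_2} (m c N : nat) (f g : L -> L) :
    \dim {:L} = m.*2 -> (#|[set x : finvect_type L | f x == g x]| <= N + c)%N ->
    (N * N.-1 <= 2 * #|finvect_type L|.-1)%N ->
  2 ^+ m.*2 - Num.sqrt 2 * 2 ^+ m - (c%:R + 1 / 2) <= (dH f g)%:R :> R.
Proof.
move=> dimL leS leN; set S := #|_| in leS.
have cardF : #|finvect_type L| = (2 ^ m.*2)%N by rewrite card_ext dimL.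
rewrite cardF -muln2 expnM in leN.
have := @le_sqrt2 R N (2 ^ m) (expn_gt0 _ _) leN; rewrite natrX => leNR.
have : (S + dH f g)%:R = 2 ^+ m.*2 :> R by rewrite dH_agree cardF natrX.
have : S%:R <= N%:R + c%:R :> R by rewrite -natrD ler_nat.
rewrite natrD; lra.
Qed.

Lemma dH_inverse_ge {R : rcfType} {L : fieldExtType 'F_2} (m : nat) (f g : L -> L) :
    \dim {:L} = m.*2 -> (forall x : L, f x = x^-1) -> affine_map g ->
  2 ^+ m.*2 - Num.sqrt 2 * 2 ^+ m - (1 + 1 / 2) <= (dH f g)%:R :> R.
Proof.
move=> dimL fE aff_g; pose S := [set x : finvect_type L | f x == g x].
apply: (natr_dH_ge (R := R) m 1 #|S :\ 0|) => //.
  by rewrite -/S (cardsD1 0 S) addnC leq_add2l leq_b1.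
apply: sidon_card => a x y a0; rewrite !inE.
move=> /andP[x0 /eqP Sx] /andP[xa0 /eqP Sxa] /andP[y0 /eqP Sy] /andP[ya0 /eqP Sya].
apply: inv_diff_inj a0 x0 xa0 y0 ya0 _; first exact: pchar2_ext.
by rewrite -!fE; apply: agree_diff aff_g _ _ _ _.
Qed.

Lemma dH_gold_ge {R : rcfType} {L : fieldExtType 'F_2} (m : nat) (g : L -> L) :
    \dim {:L} = m.*2 -> odd m.-1 -> affine_map g ->
  2 ^+ m.*2 - Num.sqrt 2 * 2 ^+ m - 1 / 2
    <= (dH (fun x : L => x ^+ (2 ^ m.-1 + 1)) g)%:R :> R.
Proof.
move=> dimL odd_m aff_g; pose f (x : L) := x ^+ (2 ^ m.-1 + 1).
pose S := [set x : finvect_type L | f x == g x].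
rewrite -[1 / 2]add0r; apply: (natr_dH_ge (R := R) m 0 #|S|) => //.
  by rewrite addn0.
apply: sidon_card => a x y a0; rewrite !inE => /eqP Sx /eqP Sxa /eqP Sy /eqP Sya.
apply: (gold_diff_inj (F := finvect_type L) m) => //; first exact: pchar2_ext.
  by rewrite card_ext dimL.
exact: (agree_diff L f g).
Qed.

Theorem theorem2 (R : rcfType) (n : nat) (L : fieldExtType 'F_2)
    (n_gt0 : (0 < n)%N) (dimL : \dim {:L} = n) :
  let h1 : L -> L := fun x => x ^+ (2 ^ n - 2) in
  let h2 : L -> L := fun x => x ^+ (2 ^ (n %/ 2 - 1) + 1) in
  [/\ (2 %| n)%N ->
        2 ^+ n - Num.sqrt 2 * 2 ^+ (n %/ 2) - 3 / 2 <= (dH_affine h1)%:R :> R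
        /\ (dH_affine h1)%:R <= 2 ^+ n - 2 ^+ (n %/ 2) - 2 :> R,
      (4 %| n)%N ->
        2 ^+ n - Num.sqrt 2 * 2 ^+ (n %/ 2) - 1 / 2 <= (dH_affine h2)%:R :> R
        /\ (dH_affine h2)%:R <= 2 ^+ n - 2 ^+ (n %/ 2) - 2 :> R,
      (2 %| n)%N -> (dH_affine h1)%:R <= 2 ^+ n - 2 ^+ (n %/ 2) - 1 :> R
    & (4 %| n)%N -> (dH_affine h2)%:R <= 2 ^+ n - 2 ^+ (n %/ 2) - 1 :> R].
Proof.
move=> h1 h2.
have natr_ub (m N : nat) : (N + (2 ^ m + 2) <= 2 ^ m.*2)%N ->
    N%:R <= 2 ^+ m.*2 - 2 ^+ m - 2 :> R.
  by rewrite -(ler_nat R) !natrD !natrX; lra.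
have expf_n (x : L) : x ^+ (2 ^ n) = x.
  by rewrite -dimL -card_ext; exact: (@expf_card (finvect_type L)).
have h1_bounds : (2 %| n)%N ->
    2 ^+ n - Num.sqrt 2 * 2 ^+ (n %/ 2) - 3 / 2 <= (dH_affine h1)%:R :> R
    /\ (dH_affine h1)%:R <= 2 ^+ n - 2 ^+ (n %/ 2) - 2 :> R.
  move=> n_even; have [m nE] : exists m, n = m.*2 by exists (n %/ 2)%N; lia.
  have -> : (n %/ 2 = m)%N by lia.
  (* This makes the truncated exponent [2 ^ n - 2] exact and positive, so that [h1 0 = 0], the
     conventional value of [0^-1]. *)
  have ge4 : (2 ^ 2 <= 2 ^ n)%N by rewrite leq_exp2l //; lia.
  rewrite nE in dimL *.
  have h1E x : h1 x = x^-1.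
    have [->|x0] := eqVneq x 0.
      rewrite /h1 invr0; have [k ->] : exists k, (2 ^ n - 2)%N = k.+1.
        by exists (2 ^ n - 3)%N; lia.
      by rewrite expr0n.
    (* After multiplication by [x] twice, both sides are [x], the left one as [x ^+ (2 ^ n)]. *)
    apply: (mulfI x0); apply: (mulfI x0); rewrite mulfV // mulr1 /h1 -!exprS.
    by have -> : (2 ^ n - 2).+2 = (2 ^ n)%N by lia.
  split.
    have [g aff_g ->] := dH_affine_attained h1.
    apply: le_trans (dH_inverse_ge (R := R) _ h1 g dimL h1E aff_g); lra.
  apply/natr_ub/(dH_affine_circle L m m h1 dimL); first by rewrite h1E invr0.
  move=> x; rewrite addn1 exprS => x1; rewrite h1E.
  have x0 : x != 0 by apply: contra_eq_neq x1 => ->; rewrite mul0r eq_sym oner_neq0.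
  by apply: (mulfI x0); rewrite mulfV.
have h2_bounds : (4 %| n)%N ->
    2 ^+ n - Num.sqrt 2 * 2 ^+ (n %/ 2) - 1 / 2 <= (dH_affine h2)%:R :> R
    /\ (dH_affine h2)%:R <= 2 ^+ n - 2 ^+ (n %/ 2) - 2 :> R.
  move=> n_4; have [m nE] : exists m, n = m.*2 by exists (n %/ 2)%N; lia.
  have mE : (n %/ 2 = m)%N by lia.
  (* Since 4 divides [n], [m] is even; [n_gt0] excludes [m = 0], whose truncated predecessor would
     be even. *)
  have odd_m : odd m.-1 by lia.
  have h2E x : h2 x = x ^+ (2 ^ m.-1 + 1) by rewrite /h2 mE subn1.
  rewrite mE nE; rewrite nE in dimL; split.
    have [g aff_g ->] := dH_affine_attained h2; rewrite /h2 mE subn1.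
    exact: dH_gold_ge.
  (* The exponent [2 ^ n.-1] is the square root, as squaring it gives [x ^+ (2 ^ n) = x]; hence it
     recovers [h2 x] from [h2 x ^+ 2 = x]. *)
  apply/natr_ub/(dH_affine_circle L m n.-1 h2 dimL) => [|x x1].
    by rewrite h2E addn1 expr0n.
  have h2_sqr : h2 x ^+ 2 = x.
    rewrite h2E -exprM mulnDl -expnSr prednK ?mul1n; last by lia.
    by rewrite addn2 exprS -(addn1 (2 ^ m)) x1 mulr1.
  rewrite -[LHS]expf_n.
  have -> : (2 ^ n = 2 * 2 ^ n.-1)%N by rewrite -expnS prednK.
  by rewrite exprM h2_sqr.
by split=> // [/h1_bounds[_]|/h2_bounds[_]]; lra.
Qed.
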